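(* Let $\ell\ge 1$ and $n\ge 2$ be integers and let $p$ be the minimal prime divisor of $n$. Then $$\beta_{sep}(C_{\ell n}\oplus C_{n})=\ell n+\frac{n}{p}.$$
   Context: $C_n$ denotes the cyclic group of order $n$. Let $G$ be a finite group and let $V$ be a finite dimensional complex vector space on which $G$ acts by linear transformations (a finite dimensional $G$-module). $\mathbb{C}[V]$ is the algebra of polynomial functions on $V$, and $\mathbb{C}[V]^G$ is the subalgebra of $G$-invariants, i.e. of polynomial functions that are constant along the $G$-orbits. $\beta_{sep}(G,V)$ is the minimal positive integer $d$ such that for any $v,w\in V$ with $Gv\ne Gw$ there exists a homogeneous $f\in\mathbb{C}[V]^G$ of degree at most $d$ with $f(v)\ne f(w)$. The separating Noether number of $G$ is $$\beta_{sep}(G):=\sup_V\{\beta_{sep}(G,V)\},$$ where $V$ ranges over all finite dimensional (complex) $G$-modules; one has $\beta_{sep}(G)\le|G|$. *)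

(* Defs.v *)
From HB Require Import structures.
From mathcomp Require Import all_boot all_order all_algebra all_fingroup.
From mathcomp Require Import all_solvable all_character.
From mathcomp Require Import boolp classical_sets reals complex.
From mathcomp Require Import mpoly.

Set Implicit Arguments.
Unset Strict Implicit.
Unset Printing Implicit Defensive.

Import Order.TTheory GRing.Theory Num.Theory.
Local Open Scope ring_scope.

(* A finite dimensional G-module is given, in coordinates, by a matrix         *)
(* representation rG of degree n: V is the space 'cV[C]_n of column vectors    *)
(* over C = R[i], with g acting by v |-> rG g *m v.  C[V] is {mpoly C[n]}.     *)
Section GModule.
Context {R : realType} {gT : finGroupType} {G : {group gT}} {n : nat}.
Variable rG : mx_representation R[i] G n.
Implicit Types (v w : 'cV[R[i]]_n) (f : {mpoly R[i][n]}) (d e : nat).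

Definition evalV f v : R[i] := f.@[fun i => v i ord0].

Definition orbitV v : set 'cV[R[i]]_n :=
  [set u | exists2 g, g \in G & u = rG g *m v]%classic.

Definition invariant f : Prop :=
  forall g v, g \in G -> evalV f (rG g *m v) = evalV f v.

Definition separating_degree d : Prop :=
  forall v w, orbitV v <> orbitV w ->
  exists f e, [/\ invariant f, f \is e.-homog, (e <= d)%N
                & evalV f v <> evalV f w].

(* The coefficients of \prod_g ('X - L_g), for L_g the g-translates of a linear *)
(* form L, are homogeneous invariants of degree at most #|G|, and L can be      *)
(* chosen so that they separate two given orbits.                              *)
Lemma coef_prod_XsubC_homog (s : seq {mpoly R[i][n]}) k :
    {in s, forall l, l \is 1.-homog} -> (k <= size s)%N ->
  (\prod_(l <- s) ('X - l%:P))`_k \is (size s - k).-homog.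
Proof.
elim: s k => [|l s IHs] k hs.
  by rewrite leqn0 => /eqP->; rewrite big_nil coefC eqxx; exact: dhomog1.
have hl : l \is 1.-homog by apply: hs; rewrite mem_head.
have {}IHs j : (j <= size s)%N ->
    (\prod_(l <- s) ('X - l%:P))`_j \is (size s - j).-homog.
  by apply: IHs => l' sl'; apply: hs; rewrite inE sl' orbT.
rewrite big_cons mulrBl coefB coefXM coefCM /= => lek.
apply: rpredB.
  case: k lek => [|k] lek /=; first exact: rpred0.
  by rewrite subSS IHs.
case: (leqP k (size s)) => [leks|ltsk].
  by rewrite subSn // -add1n; apply: dhomogM => //; exact: IHs.
by rewrite nth_default ?mulr0 ?rpred0 // size_prod_XsubC.
Qed.

Lemma separating_degree_card : separating_degree #|G|.
Proof.
move=> v w neq_vw.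
pose q (g : gT) : {poly R[i]} := rVpoly (v - rG g *m w)^T.
have q_neq0 g : g \in G -> q g != 0.
  move=> Gg; apply/eqP => /(congr1 (@poly_rV _ n)).
  rewrite rVpolyK linear0 => /(congr1 trmx); rewrite trmxK trmx0.
  move/subr0_eq => def_v; apply: neq_vw; apply/seteqP.
  split=> u [h Gh ->] /=.
    by exists (h * g)%g; rewrite ?groupM // repr_mxM // -mulmxA -def_v.
  exists (h * g^-1)%g; first by rewrite groupM ?groupV.
  by rewrite def_v mulmxA -repr_mxM ?groupM ?groupV // mulgKV.
have [t t_nroot] : exists t : R[i], forall g, g \in G -> ~~ root (q g) t.
  pose Q := \prod_(g in G) q g.
  have Q_neq0 : Q != 0.
    by rewrite prodf_seq_neq0; apply/allP => g _; apply/implyP/q_neq0.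
  pose rs := [seq (i%:R : R[i]) | i <- iota 0 (size Q)].
  have rs_uniq : uniq rs.
    by rewrite map_inj_uniq ?iota_uniq // => i j /eqP; rewrite eqr_nat => /eqP.
  have /allPn[t _ tQ] : ~~ all (root Q) rs.
    apply/negP => rsQ; have := max_poly_roots Q_neq0 rsQ rs_uniq.
    by rewrite size_map size_iota ltnn.
  by exists t => g Gg; apply: contra tQ; rewrite /Q (bigD1 g) //= rootM => ->.
pose a : 'rV[R[i]]_n := \row_i t ^+ i.
pose L (g : gT) : {mpoly R[i][n]} := \sum_i (a *m rG g) 0 i *: 'X_i.
pose lam (x : 'cV[R[i]]_n) : R[i] := (a *m x) 0 0.
have L_homog g : L g \is 1.-homog.
  by apply: rpred_sum => i _; apply: dhomogZ; rewrite dhomogX /= mdeg1.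
have LE g x : evalV (L g) x = lam (rG g *m x).
  rewrite /evalV /L raddf_sum /= /lam mulmxA [RHS]mxE.
  apply: eq_bigr => i _.
  by rewrite mevalZ mevalXU.
pose s := [seq L g | g <- enum G].
pose P : {poly {mpoly R[i][n]}} := \prod_(l <- s) ('X - l%:P).
pose Px (x : 'cV[R[i]]_n) : {poly R[i]} :=
  \prod_(g in G) ('X - (lam (rG g *m x))%:P).
have size_s : size s = #|G| by rewrite size_map -cardE.
have coefP x k : evalV P`_k x = (Px x)`_k.
  have factorE g : map_poly (meval (fun i => x i ord0)) ('X - (L g)%:P) =
      'X - (lam (rG g *m x))%:P.
    by rewrite raddfB /= map_polyX map_polyC /= -LE.
  rewrite /evalV -coef_map /P /Px; congr (_ `_ _).
  rewrite rmorph_prod /= big_map big_enum /=.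
  by under eq_bigr => g _ do rewrite factorE.
have Px_inv g x : g \in G -> Px (rG g *m x) = Px x.
  move=> Gg; rewrite /Px [RHS](reindex_inj (mulIg g)) /=.
  apply: eq_big => [h|h Gh]; first by rewrite groupMr.
  by rewrite mulmxA repr_mxM.
have neqP : Px v != Px w.
  have rv : root (Px v) (lam v).
    by rewrite /Px (bigD1 1%g) //= rootM repr_mx1 mul1mx root_XsubC eqxx.
  apply: contraTneq rv => ->; rewrite /Px /root horner_prod prodf_seq_neq0.
  apply/allP => g _; apply/implyP => Gg.
  rewrite hornerXsubC /lam; apply: contraNneq (t_nroot g Gg).
  have -> : (a *m v) 0 0 - (a *m (rG g *m w)) 0 0 = (q g).[t].
    have <- : (a *m (v - rG g *m w)) 0 0 = (a *m v) 0 0 - (a *m (rG g *m w)) 0 0.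
      by rewrite mulmxBr [LHS]mxE [X in _ + X]mxE.
    rewrite /q /rVpoly horner_poly [LHS]mxE; apply: eq_bigr => i _.
    by rewrite valK [a _ _]mxE [_^T _ _]mxE mulrC.
  by rewrite /root => ->.
have [k neq_k] : exists k, (Px v)`_k <> (Px w)`_k.
  apply/existsNP => eqk; move/eqP: neqP; apply; apply/polyP => k; exact: eqk.
have lek : (k <= #|G|)%N.
  rewrite leqNgt; apply/negP => ltk; apply: neq_k; rewrite -!coefP.
  have -> : P`_k = 0 by rewrite nth_default // /P size_prod_XsubC size_s.
  by rewrite /evalV !raddf0.
exists P`_k, (#|G| - k)%N; split; last by rewrite !coefP.
- by move=> g x Gg; rewrite !coefP Px_inv.
- rewrite -size_s; apply: coef_prod_XsubC_homog; last by rewrite size_s.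
  by move=> l /mapP[g _ ->].
- exact: leq_subr.
Qed.

Lemma exists_separating_degree :
  exists d, (0 < d)%N && `[< separating_degree d >].
Proof.
by exists #|G|; rewrite cardG_gt0; apply/asboolP/separating_degree_card.
Qed.

Definition beta_sep_mod : nat := ex_minn exists_separating_degree.

Lemma beta_sep_mod_le : (beta_sep_mod <= #|G|)%N.
Proof.
rewrite /beta_sep_mod; case: ex_minnP => m _; apply.
by rewrite cardG_gt0; apply/asboolP/separating_degree_card.
Qed.

End GModule.

Section SeparatingNoetherNumber.
Variables (R : realType) (gT : finGroupType) (G : {group gT}).

Definition is_beta_sep_mod (d : nat) : bool :=
  `[< exists n (rG : mx_representation R[i] G n), beta_sep_mod rG = d >].

Lemma exists_beta_sep_mod : exists d, is_beta_sep_mod d.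
Proof.
have rP : mx_repr G (fun=> 1%:M : 'M[R[i]]_0).
  by split=> // x y _ _; rewrite mulmx1.
by eexists; apply/asboolP; exists 0%N, (MxRepresentation rP).
Qed.

Lemma is_beta_sep_mod_le d : is_beta_sep_mod d -> (d <= #|G|)%N.
Proof. by move=> /asboolP[n [rG <-]]; exact: beta_sep_mod_le. Qed.

(* The supremum of the beta_sep_mod rG, attained since they are bounded.       *)
Definition beta_sep : nat := ex_maxn exists_beta_sep_mod is_beta_sep_mod_le.

End SeparatingNoetherNumber.

(* Main.v *)
Require Import Defs.
From HB Require Import structures.
From mathcomp Require Import all_boot all_order all_algebra all_fingroup.
From mathcomp Require Import all_solvable all_character.
From mathcomp Require Import boolp classical_sets reals complex.
From mathcomp Require Import mpoly.
From mathcomp Require Import separable cyclotomic zify ring.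

Set Implicit Arguments.
Unset Strict Implicit.
Unset Printing Implicit Defensive.

Import Order.TTheory GRing.Theory Num.Theory.
Local Open Scope ring_scope.

(** Put N = l n.  After diagonalizing the action, the coordinates carry
    characters (al_i, be_i) in Z/N x Z/n, and an invariant monomial is a
    nonnegative point of the lattice L of all m in Z^k with m.al = 0 mod N and
    m.be = 0 mod n.  Two vectors with the same short monomial invariants differ
    by a torus element whose exponent vector th is orthogonal mod N to the short
    points of L.  If the short points generate L then th is orthogonal to L, and
    by duality of Z/N-modules th comes from an element of the group.

    To see that points of length at most N + n/p generate L, localize at a
    prime q: by Nakayama the group of characters is generated at q by two of the
    given ones (by one if q does not divide n), so k = 3 (resp. k = 2) is enough.
    For k = 3, let gam generate the group of coordinate sums of points of L.
    Some point u of L with sum gam is not generated by short ones.  If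
    gam <= n/q, then u or - u, reduced mod N, is short.  If gam > n/q, let D be
    the lattice of points of L with sum zero.  A fundamental box of D, with sides
    dl and b, satisfies dl * b * gam <= N n, since it injects with [0, gam) into
    the group of characters, and q divides dl and b; these force
    dl + b - 2 <= N - gam, so that - u can be moved modulo D and N Z^3 to a
    nonnegative point with sum N - gam.

    The bound is attained for the characters e1, e2, e1 - (n/p) e2: an invariant
    monomial of degree less than N + n/p has exponent of the third variable
    divisible by p, so it does not distinguish (1,1,1) from (1,1,eta) with eta a
    primitive p-th root of unity. *)

(** * Subgroups of Z and the box inequality *)

Lemma int_subgroup_gen (P : int -> Prop) (N : nat) :
    (0 < N)%N -> P N%:Z -> (forall x y, P x -> P y -> P (x - y)) ->
  exists g : nat, [/\ (0 < g)%N, P g%:Z & forall x, P x -> (g%:Z %| x)%Z].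
Proof.
move=> N0 PN PB.
have P0 : P 0 by rewrite -(subrr N%:Z); apply: PB.
have PD x y : P x -> P y -> P (x + y).
  by move=> Px Py; have := PB _ _ Px (PB _ _ P0 Py); rewrite sub0r opprK.
have PMn x k : P x -> P (x *+ k).
  by move=> Px; elim: k => [|k IH]; rewrite ?mulr0n ?mulrS //; apply: PD.
have PM x c : P x -> P (c * x).
  move=> Px; rewrite mulrC -mulrzz; case: c => k; first exact: PMn.
  by rewrite NegzE mulrNz -sub0r; apply: PB => //; apply: PMn.
have exP : exists k : nat, (0 < k)%N && `[< P k%:Z >].
  by exists N; rewrite N0; apply/asboolP.
case: (ex_minnP exP) => g /andP[g0 /asboolP Pg] gmin.
exists g; split=> // x Px; apply/dvdz_mod0P.
have r0 : 0 <= (x %% g)%Z by apply: modz_ge0; lia.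
have rg : (x %% g)%Z < g by apply: ltz_pmod.
have Pr : P (x %% g)%Z by rewrite /modz; apply: PB => //; apply: PM.
case E: (x %% g)%Z r0 rg Pr => [[|k]|k] // _ rg Pr.
have := gmin k.+1; rewrite ltn0Sn /= => /(_ (asboolT Pr)); lia.
Qed.

(* [dl] and [b] are the sides of the fundamental box of the sum-zero lattice, *)
(* [gam] generates the coordinate sums, and [n'] is n / q.                    *)
Lemma gamma_bound (N gam n' q dl b M : int) :
    2 <= q -> 0 < n' -> n' < gam -> 0 < M -> N = q * M ->
    (gam %| M)%Z -> (n' %| M)%Z -> q <= dl -> q <= b ->
    dl * b * gam <= N * (q * n') ->
  dl + b - 2 <= N - gam.
Proof.
move=> q2 n0 ng M0 EN /dvdzP[g Eg] /dvdzP[h Eh] qd qb cnt.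
have gam2 : 2 <= gam by lia.
have g1 : 1 <= g by clear -Eg M0 gam2; nia.
suff bound : gam * (gam + q - 2) <= q * (M * (gam - n')).
  (* This is (dl - q) (b - q) >= 0; it turns the product bound [cnt] into a bound on dl + b. *)
  have : q * (dl + b) <= dl * b + q * q by clear -qd qb; nia.
  move=> H.
  have : gam * (q * (dl + b)) <= N * (q * n') + gam * (q * q).
    have := ler_wpM2l (_ : 0 <= gam) H; clear -cnt gam2; lia.
  have -> : N * (q * n') + gam * (q * q) = q * (N * n' + gam * q) by ring.
  rewrite mulrCA ler_pM2l; last by lia.
  move=> H2; rewrite -(ler_pM2l (_ : 0 < gam)); last by lia.
  by rewrite EN in H2 *; clear -H2 bound; lia.
suff H : gam * gam <= 2 * (M * (gam - n')).
  have : 0 <= (q - 2) * (gam - 2) by apply: mulr_ge0; lia.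
  move=> H1; have : 0 <= gam * ((q - 2) * (gam - 2)) by apply: mulr_ge0; lia.
  have : q * (gam * gam) <= q * (2 * (M * (gam - n'))) by rewrite ler_pM2l //;
    lia.
  clear; lia.
(* If 2 n' <= gam, then gam <= M is enough. Otherwise gam < 2 n', and M = g gam = h n' with g < h
   gives M (gam - n') = gam (h - g) n' >= gam n'. *)
have [hl|hl] := lerP gam (2 * (gam - n')).
  have : gam <= M by clear -Eg g1 gam2; nia.
  clear -hl gam2; nia.
have g2 : 2 <= g.
  have : g != 1; last by lia.
  apply/eqP => E1; rewrite E1 mul1r in Eg.
  have Egh : gam = h * n' by rewrite -Eg.
  have : 1 < h by clear -Egh ng n0; nia.
  by clear -Egh hl n0; nia.
have gh : g < h by clear -Eg Eh ng n0 g2; nia.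
have H : n' <= g * (gam - n').
  have : g * (gam - n') = (h - g) * n' by rewrite mulrBr -Eg Eh; ring.
  by move=> ->; clear -gh n0; nia.
have : gam * n' <= M * (gam - n') by rewrite Eg; clear -H gam2; nia.
by clear -hl gam2; nia.
Qed.

Lemma absz_mod_lt (x : int) (k : nat) : (0 < k)%N -> (`|(x %% k)%Z| < k)%N.
Proof.
move=> k0; rewrite -ltz_nat gez0_abs ?modz_ge0 ?ltz_pmod //.
by rewrite eqz_nat -lt0n.
Qed.

Lemma absz_mod_inj (k : nat) (x y : int) : (0 < k)%N ->
  `|(x %% k)%Z|%N = `|(y %% k)%Z|%N -> (k%:Z %| x - y)%Z.
Proof.
move=> k0 E; rewrite -eqz_mod_dvd; apply/eqP.
rewrite -[LHS]gez0_abs ?E ?gez0_abs // modz_ge0 // eqz_nat -lt0n //.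
Qed.

Lemma dvdz_ord_inj (k : nat) (i j : 'I_k) : (k%:Z %| i%:Z - j%:Z)%Z -> i = j.
Proof.
rewrite -eqz_mod_dvd !modz_nat => /eqP[].
by rewrite !modn_small // => /val_inj.
Qed.

(** * Lattice points supported on three characters *)

Definition lin3 (a b c x y z : int) := x * a + y * b + z * c.

Section Triple.
Variables (N n q Q r : nat) (a1 a2 a3 b1 b2 b3 t1 t2 t3 : int).
Hypotheses (q_prime : prime q) (q_n : (q %| n)%N) (le_r : (n %/ q <= r)%N).
Hypotheses (N_gt0 : (0 < N)%N) (n_N : (n %| N)%N).
Hypothesis Q_q : exists e, Q = (q ^ e)%N.

(* [Q] being a power of [q], a point is good if th is orthogonal to it at q. *)
Local Notation L x y z :=
  ((N%:Z %| lin3 a1 a2 a3 x y z)%Z /\ (n%:Z %| lin3 b1 b2 b3 x y z)%Z).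
Local Notation good x y z := (is_true (Q%:Z %| lin3 t1 t2 t3 x y z)%Z).

Hypothesis short : forall x y z : int, 0 <= x -> 0 <= y -> 0 <= z ->
  x + y + z <= (N + r)%N%:Z -> L x y z -> good x y z.

Lemma lin3D a b c k k' x y z x' y' z' :
  lin3 a b c (k * x + k' * x') (k * y + k' * y') (k * z + k' * z') =
  k * lin3 a b c x y z + k' * lin3 a b c x' y' z'.
Proof. rewrite /lin3; ring. Qed.

Lemma rel_lin k k' x y z x' y' z' X Y Z : L x y z -> L x' y' z' ->
  X = k * x + k' * x' -> Y = k * y + k' * y' -> Z = k * z + k' * z' -> L X Y Z.
Proof.
move=> [La Lb] [La' Lb'] -> -> ->; rewrite !lin3D.
by split; apply: rpredD; apply: dvdz_mull.
Qed.

Lemma good_lin k k' x y z x' y' z' X Y Z : good x y z -> good x' y' z' ->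
  X = k * x + k' * x' -> Y = k * y + k' * y' -> Z = k * z + k' * z' ->
    good X Y Z.
Proof.
by move=> g g' -> -> ->; rewrite lin3D; apply: rpredD; apply: dvdz_mull.
Qed.

(** c is invertible modulo Q, a power of q. *)
Lemma good_cancel c x y z : ~~ (q %| c)%N ->
  good (c%:Z * x) (c%:Z * y) (c%:Z * z) -> good x y z.
Proof.
move=> qc.
have -> : lin3 t1 t2 t3 (c%:Z * x) (c%:Z * y) (c%:Z * z) =
  c%:Z * lin3 t1 t2 t3 x y z by rewrite /lin3; ring.
rewrite Gauss_dvdzr // coprimezE; case: Q_q => e ->.
by apply: coprimeXl; rewrite prime_coprime.
Qed.

Lemma rel_mulN x y z : L (N%:Z * x) (N%:Z * y) (N%:Z * z).
Proof.
have E a b c : lin3 a b c (N%:Z * x) (N%:Z * y) (N%:Z * z) =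
  N%:Z * lin3 a b c x y z by rewrite /lin3; ring.
by rewrite !E; split; apply: dvdz_mulr; rewrite ?dvdzz // dvdzE.
Qed.

(** N times a basis vector is itself short, since N <= N + r. Hence goodness depends only on
    residues mod N. *)
Lemma good_mulN x y z : good (N%:Z * x) (N%:Z * y) (N%:Z * z).
Proof.
have g1 : good N 0 0.
  apply: short; [by []..|by rewrite ?addr0 ?add0r lez_nat leq_addr|].
  by have := rel_mulN 1 0 0; rewrite mulr1 mulr0.
have g2 : good 0 N 0.
  apply: short; [by []..|by rewrite ?addr0 ?add0r lez_nat leq_addr|].
  by have := rel_mulN 0 1 0; rewrite mulr1 mulr0.
have g3 : good 0 0 N.
  apply: short; [by []..|by rewrite ?addr0 ?add0r lez_nat leq_addr|].
  by have := rel_mulN 0 0 1; rewrite mulr1 mulr0.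
have g12 := good_lin (k := x) (k' := y) g1 g2 erefl erefl erefl.
by apply: (good_lin (k := 1) (k' := z) g12 g3); ring.
Qed.

Lemma rel_mod x y z : L x y z -> L (x %% N)%Z (y %% N)%Z (z %% N)%Z.
Proof.
move=> Lx.
by apply: (rel_lin (k := 1) (k' := -1)
  Lx (rel_mulN (x %/ N)%Z (y %/ N)%Z (z %/ N)%Z));
  rewrite /modz; ring.
Qed.

Lemma good_mod x y z : good (x %% N)%Z (y %% N)%Z (z %% N)%Z -> good x y z.
Proof.
move=> gx.
by apply: (good_lin (k := 1) (k' := 1) gx
  (good_mulN (x %/ N)%Z (y %/ N)%Z (z %/ N)%Z)); rewrite /modz; ring.
Qed.

(** The two residues add up to 0 or N. The case x = 0 is singled out because a zero coordinate then
    adds nothing to either sum, which [good_pair] exploits. *)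
Lemma mod_opp (x : int) : [/\ 0 <= (x %% N)%Z, 0 <= (- x %% N)%Z,
  (x %% N)%Z + (- x %% N)%Z <= N & x = 0 -> (x %% N)%Z = 0 /\ (- x %% N)%Z = 0].
Proof.
have N0 : (N%:Z != 0) by rewrite eqz_nat -lt0n.
split; try exact: modz_ge0; last by move=> ->; rewrite oppr0 mod0z.
have h1 : (x %% N)%Z < N by apply: ltz_pmod.
have h2 : (- x %% N)%Z < N by apply: ltz_pmod.
have : (N%:Z %| (x %% N)%Z + (- x %% N)%Z)%Z.
  by apply/dvdz_mod0P; rewrite modzDm subrr mod0z.
case/dvdzP => k E.
have k2 : k * N%:Z < 2 * N%:Z by rewrite -E; clear -h1 h2; lia.
have {}k2 : k < 2 by move: k2; rewrite ltr_pM2r.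
by rewrite E; clear -k2; nia.
Qed.

Lemma good_opp x y z : good (- x) (- y) (- z) -> good x y z.
Proof. by move=> g; apply: (good_lin (k := -1) (k' := 0) g g); ring. Qed.

Lemma rel_opp x y z : L x y z -> L (- x) (- y) (- z).
Proof. by move=> g; apply: (rel_lin (k := -1) (k' := 0) g g); ring. Qed.

(* The reductions of m and - m mod N have total sum at most 2 N. *)
Lemma good_pair x y z : L x y z -> x = 0 \/ y = 0 \/ z = 0 -> good x y z.
Proof.
move=> Lx z0.
have [x1 x2 x3 x4] := mod_opp x; have [y1 y2 y3 y4] := mod_opp y.
have [z1 z2 z3 z4] := mod_opp z.
have H : (x %% N)%Z + (y %% N)%Z + (z %% N)%Z <= N \/
    (- x %% N)%Z + (- y %% N)%Z + (- z %% N)%Z <= N.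
  move: x3 y3 z3 x4 y4 z4; clear -z0.
  move: (x %% N)%Z (- x %% N)%Z (y %% N)%Z (- y %% N)%Z => X X' Y Y'.
  move: (z %% N)%Z (- z %% N)%Z => Z Z' x3 y3 z3 x4 y4 z4.
  by case: z0 => [/x4|[/y4|/z4]] [E1 E2]; rewrite E1 E2 {E1 E2 x4 y4 z4}; lia.
have le_short s : s <= N%:Z -> s <= (N + r)%N%:Z.
  by move/le_trans; apply; rewrite lez_nat leq_addr.
case: H => /le_short H; last apply: good_opp;
  apply: good_mod; apply: short=> //.
  exact: rel_mod.
exact/rel_mod/rel_opp.
Qed.

(* A point with sum g mod N has a reduction mod N with sum g, N + g or        *)
(* 2 N + g; in the last case that of its opposite has sum at most N - g.      *)
Lemma good_small_sum x y z (g : int) : L x y z -> 0 <= g -> g <= r ->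
  (N%:Z %| x + y + z - g)%Z -> good x y z.
Proof.
move=> Lx g0 gn Ng.
have [x1 x2 x3 _] := mod_opp x; have [y1 y2 y3 _] := mod_opp y.
have [z1 z2 z3 _] := mod_opp z.
have : (N%:Z %| (x %% N)%Z + (y %% N)%Z + (z %% N)%Z - g)%Z.
  have -> : (x %% N)%Z + (y %% N)%Z + (z %% N)%Z - g =
    (x + y + z - g) - N%:Z * ((x %/ N)%Z + (y %/ N)%Z + (z %/ N)%Z).
    by rewrite /modz; ring.
  by apply: rpredB => //; apply: dvdz_mulr.
case/dvdzP => k E.
have [H|H] := lerP k 1.
  apply: good_mod; apply: short => //; last exact: rel_mod.
  rewrite PoszD; move: E gn; clear -H; move: (x %% N)%Z (y %% N)%Z (z %% N)%Z.
  move=> X Y Z E gn.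
  have : k * N%:Z <= N%:Z by nia.
  by clear -E gn; lia.
apply: good_opp; apply: good_mod; apply: short => //;
  last exact/rel_mod/rel_opp.
rewrite PoszD; move: E x3 y3 z3; clear -H g0.
move: (x %% N)%Z (- x %% N)%Z (y %% N)%Z (- y %% N)%Z => X X' Y Y'.
move: (z %% N)%Z (- z %% N)%Z => Z Z' E x3 y3 z3.
have : 2 * N%:Z <= k * N%:Z by nia.
by clear -E x3 y3 z3 g0; lia.
Qed.

Lemma good_triple x y z : L x y z -> good x y z.
Proof.
move=> Lm; case: (EM (good x y z)) => // badm.
pose S k := exists x y z, L x y z /\ x + y + z = k.
have [||gam [gam0 [u1 [u2 [u3 [Lu Eu]]]] gamP]] := @int_subgroup_gen S N N_gt0.
- by exists N%:Z, 0, 0; rewrite !addr0; split=> //; have := rel_mulN 1 0 0;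
  rewrite mulr1 mulr0.
- move=> k k' [x1 [y1 [z1 [L1 E1]]]] [x2 [y2 [z2 [L2 E2]]]].
  exists (x1 - x2), (y1 - y2), (z1 - z2); split; last by rewrite -E1 -E2; ring.
  by apply: (rel_lin (k := 1) (k' := -1) L1 L2); ring.
have sum0 a b c : L a b c -> a + b + c = 0 -> good a b c.
  by move=> La s0; apply: (good_small_sum La (g := 0)); rewrite ?s0.
have badu : ~ good u1 u2 u3.
  move=> gu; apply: badm.
  have /gamP/dvdzP[k Ek] : S (x + y + z) by exists x, y, z.
  have g0 : good (x - k * u1) (y - k * u2) (z - k * u3).
    apply: sum0; first by apply: (rel_lin (k := 1) (k' := - k) Lm Lu); ring.
    transitivity (x + y + z - k * (u1 + u2 + u3)); first by ring.
    by rewrite Eu Ek subrr.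
  by apply: (good_lin (k := 1) (k' := k) g0 gu); ring.
have [gle|glt] := leqP gam (n %/ q).
  by case: badu; apply: (good_small_sum Lu (g := gam));
    rewrite ?Eu ?subrr // lez_nat (leq_trans gle).
(* Each use shows that c u is good by subtracting a good point so that the difference has sum zero
   or a zero coordinate; c is N / gam, dl and b in turn. *)
have bad_mul c : good (c%:Z * u1) (c%:Z * u2) (c%:Z * u3) -> (q %| c)%N.
  by move=> gc; apply/negPn/negP => qc; apply: badu; apply: good_cancel gc.
have gN : (gam %| N)%N.
  apply: (gamP N%:Z); exists N%:Z, 0, 0; rewrite !addr0; split=> //.
  by have := rel_mulN 1 0 0; rewrite mulr1 mulr0.
have gqN : (q * gam %| N)%N.
  rewrite -(divnK gN) dvdn_pmul2r //; apply: bad_mul.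
  pose M := (N %/ gam)%N.
  have g0 : good (M%:Z * u1 - N%:Z * 1) (M%:Z * u2 - N%:Z * 0)
    (M%:Z * u3 - N%:Z * 0).
    apply: sum0; first by apply: (rel_lin (k := M%:Z) (k' := - 1)
      Lu (rel_mulN 1 0 0)); ring.
    transitivity (M%:Z * (u1 + u2 + u3) - N%:Z); first by ring.
    by rewrite Eu -PoszM divnK ?subrr.
  by apply: (good_lin (k := 1) (k' := 1) g0 (good_mulN 1 0 0)); rewrite -/M;
    ring.
(* Triangular basis of the lattice D of sum-zero points: (dl, 0, - dl) spans those with y = 0, and
   (a, b, - a - b) has the least positive second coordinate. *)
pose P1 k := L k 0 (- k).
have [||dl [dl0 Ldl dlP]] := @int_subgroup_gen P1 N N_gt0.
- by have := rel_mulN 1 0 (-1); rewrite /P1 mulr1 mulr0 mulrN1.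
- by move=> k k' L1 L2; apply: (rel_lin (k := 1) (k' := -1) L1 L2); ring.
pose P2 k := exists a, L a k (- a - k).
have [||b [b0 [a Lb] bP]] := @int_subgroup_gen P2 N N_gt0.
- by exists 0; have := rel_mulN 0 1 (-1);
  rewrite mulr1 mulr0 mulrN1 oppr0 sub0r.
- move=> k k' [a4 L1] [a5 L2]; exists (a4 - a5).
  by apply: (rel_lin (k := 1) (k' := -1) L1 L2); ring.
have q_dl : (q %| dl)%N.
  apply: bad_mul.
  have g1 : good dl 0 (- dl%:Z) by apply: sum0 => //; ring.
  have g0 : good (dl%:Z * u1 - u1 * dl) (dl%:Z * u2 - u1 * 0)
    (dl%:Z * u3 + u1 * dl%:Z).
    apply: good_pair; last by left; ring.
    by apply: (rel_lin (k := dl%:Z) (k' := - u1) Lu Ldl); ring.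
  by apply: (good_lin (k := 1) (k' := u1) g0 g1); ring.
have q_b : (q %| b)%N.
  apply: bad_mul.
  have g1 : good a b (- a - b%:Z) by apply: sum0 => //; ring.
  have g0 : good (b%:Z * u1 - u2 * a) (b%:Z * u2 - u2 * b)
    (b%:Z * u3 - u2 * (- a - b%:Z)).
    apply: good_pair; last by right; left; ring.
    by apply: (rel_lin (k := b%:Z) (k' := - u2) Lu Lb); ring.
  by apply: (good_lin (k := 1) (k' := u2) g0 g1); ring.
have n_gt0 : (0 < n)%N by apply: dvdn_gt0 n_N.
(* The point (i, j, k - i - j) has sum k. If two such points give the same character, their
   difference lies in L, so gam divides k - k', then b divides j - j', then dl divides i - i'. *)
have card_le : (dl * b * gam <= N * n)%N.
  pose v (w : 'I_dl * 'I_b * 'I_gam) (c1 c2 c3 : int) : int :=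
    let: (i, j, k) := w in lin3 c1 c2 c3 i j (k%:Z - i%:Z - j%:Z).
  pose F w := (Ordinal (absz_mod_lt (v w a1 a2 a3) N_gt0),
               Ordinal (absz_mod_lt (v w b1 b2 b3) n_gt0)).
  suff /leq_card : injective F by rewrite !card_prod !card_ord.
  move=> [[i j] k] [[i' j'] k'] [].
  move=> /(absz_mod_inj N_gt0) dva /(absz_mod_inj n_gt0) dvb.
  have Ld : L (i%:Z - i'%:Z) (j%:Z - j'%:Z)
      (k%:Z - k'%:Z - (i%:Z - i'%:Z) - (j%:Z - j'%:Z)).
    have E c1 c2 c3 : lin3 c1 c2 c3 (i%:Z - i'%:Z) (j%:Z - j'%:Z)
        (k%:Z - k'%:Z - (i%:Z - i'%:Z) - (j%:Z - j'%:Z)) =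
      v (i, j, k) c1 c2 c3 - v (i', j', k') c1 c2 c3 by rewrite /v /lin3; ring.
    by rewrite !E.
  have Ek : k = k'.
    apply: dvdz_ord_inj; apply: gamP; do 3!eexists; split; first exact: Ld.
    by ring.
  have Ej : j = j'.
    apply: dvdz_ord_inj; apply: bP; exists (i%:Z - i'%:Z).
    have E : - (i%:Z - i'%:Z) - (j%:Z - j'%:Z) =
      k%:Z - k'%:Z - (i%:Z - i'%:Z) - (j%:Z - j'%:Z) by rewrite Ek; ring.
    by rewrite E.
  have Ei : i = i'.
    apply: dvdz_ord_inj; apply: dlP; rewrite /P1.
    by move: Ld; rewrite Ej Ek !subrr sub0r subr0.
  by rewrite Ei Ej Ek.
have q_gt1 := prime_gt1 q_prime.
have q_N : (q %| N)%N := dvdn_trans q_n n_N.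
have sz : dl%:Z + b%:Z - 2 <= N%:Z - gam%:Z.
  apply: (@gamma_bound N gam (n %/ q)%N q dl b (N %/ q)%N).
  - by rewrite lez_nat.
  - by rewrite ltz_nat divn_gt0 ?prime_gt0 // dvdn_leq.
  - by rewrite ltz_nat.
  - by rewrite ltz_nat divn_gt0 ?prime_gt0 // dvdn_leq.
  - by rewrite -PoszM mulnC divnK.
  - by rewrite dvdzE /= dvdn_divRL // mulnC.
  - by rewrite dvdzE /= dvdn_divRL // divnK.
  - by rewrite lez_nat dvdn_leq.
  - by rewrite lez_nat dvdn_leq.
  - by rewrite -!PoszM lez_nat [(q * _)%N]mulnC divnK.
case: badu; apply: good_opp.
(* Reduction of - u modulo the basis of D, after adding N to the third coordinate to make the sum N
   - gam. The first two coordinates then add up to at most dl + b - 2, so [sz] keeps the third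
   nonnegative. *)
pose ky := (- u2 %/ b)%Z; pose kx := ((- u1 - ky * a) %/ dl)%Z.
have Lw : L (- u1) (- u2) (- u3 + N).
  by apply: (rel_lin (k := -1) (k' := 1) Lu (rel_mulN 0 0 1)); ring.
have {}Lw : L (- u1 - ky * a) (- u2 %% b)%Z (- u3 + N + ky * (a + b%:Z)).
  by apply: (rel_lin (k := 1) (k' := - ky) Lw Lb); rewrite /modz -/ky; ring.
have {}Lw : L ((- u1 - ky * a) %% dl)%Z (- u2 %% b)%Z
    (- u3 + N + ky * (a + b%:Z) + kx * dl%:Z).
  by apply: (rel_lin (k := 1) (k' := - kx) Lw Ldl); rewrite /modz -/kx; ring.
have sum_w : ((- u1 - ky * a) %% dl)%Z + (- u2 %% b)%Z +
    (- u3 + N + ky * (a + b%:Z) + kx * dl%:Z) = N%:Z - gam%:Z.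
  by rewrite /modz -/ky -/kx -Eu; ring.
have gdl : good dl 0 (- dl%:Z) by apply: sum0 => //; ring.
have gb : good a b (- a - b%:Z) by apply: sum0 => //; ring.
have gw : good ((- u1 - ky * a) %% dl)%Z (- u2 %% b)%Z
    (- u3 + N + ky * (a + b%:Z) + kx * dl%:Z).
  have x0 : 0 <= ((- u1 - ky * a) %% dl)%Z by apply: modz_ge0;
    rewrite eqz_nat -lt0n.
  have x1 : ((- u1 - ky * a) %% dl)%Z < dl by apply: ltz_pmod.
  have y0 : 0 <= (- u2 %% b)%Z by apply: modz_ge0; rewrite eqz_nat -lt0n.
  have y1 : (- u2 %% b)%Z < b by apply: ltz_pmod.
  apply: short => //.
    by move: sz sum_w x0 x1 y0 y1; clear; move: (_ %% _)%Z (_ %% _)%Z; lia.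
  by rewrite sum_w PoszD; clear; lia.
have {}gw : good (- u1 - ky * a) (- u2 %% b)%Z (- u3 + N + ky * (a + b%:Z)).
  by apply: (good_lin (k := 1) (k' := kx) gw gdl); rewrite /modz -/kx; ring.
have {}gw : good (- u1) (- u2) (- u3 + N).
  by apply: (good_lin (k := 1) (k' := ky) gw gb); rewrite /modz -/ky; ring.
by apply: (good_lin (k := 1) (k' := -1) gw (good_mulN 0 0 1)); ring.
Qed.
End Triple.

(** * Localization at a prime and reduction to three characters *)

Lemma exists_min_valuation k (v : 'I_k.+1 -> int) (q e : nat) : prime q ->
  exists i0, exists y : 'I_k.+1 -> int,
    forall i, ((q ^ e)%N%:Z %| v i - y i * v i0)%Z.
Proof.
move=> q_prime; pose g i := gcdn `|v i| (q ^ e).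
(* The gcds with q^e are powers of q, so the least one divides all the others; Bezout writes it as a
   multiple of v i0 modulo q^e. *)
case: (@arg_minnP _ ord0 predT g isT) => i0 _ min_i0; exists i0.
have gP i : (g i0 %| g i)%N.
  have /(dvdn_pfactor _ _ q_prime)[f0 _ E0] := dvdn_gcdr `|v i0| (q ^ e).
  have /(dvdn_pfactor _ _ q_prime)[f _ E] := dvdn_gcdr `|v i| (q ^ e).
  have := min_i0 i isT; rewrite /g E0 E leq_exp2l ?prime_gt1 //.
  exact: dvdn_exp2l.
have [u [w Euw]] := Bezoutz (v i0) (q ^ e)%N.
have vP i : exists y, ((q ^ e)%N%:Z %| v i - y * v i0)%Z.
  have /dvdzP[s Es] : (gcdz (v i0) (q ^ e)%N %| v i)%Z.
    exact: dvdn_trans (gP i) (dvdn_gcdl _ _).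
  exists (s * u); rewrite Es -Euw.
  by apply/dvdzP; exists (s * w); ring.
by have [y yP] := choice vP; exists y.
Qed.

Section Family.
Variables (N n r k : nat) (al be th : 'I_k -> int).
Hypotheses (N_gt0 : (0 < N)%N) (n_N : (n %| N)%N).
Hypothesis le_r : forall q, prime q -> (q %| n)%N -> (n %/ q <= r)%N.

Local Notation dot m c := (\sum_i m i * c i).
Local Notation ind i i0 := ((i == i0)%:Z).

Let dot_triple (c : 'I_k -> int) i j h (x y z : int) :
  \sum_s (x * ind s i + y * ind s j + z * ind s h) * c s
  = lin3 (c i) (c j) (c h) x y z.
Proof.
have E (a : int) (i0 : 'I_k) : \sum_s a * ind s i0 * c s = a * c i0.
  rewrite (bigD1 i0) //= eqxx mulr1 big1 ?addr0 // => s /negPf->.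
  by rewrite mulr0 mul0r.
by under eq_bigr do rewrite !mulrDl; rewrite !big_split /= !E.
Qed.

Lemma family_good_prime (q Q : nat) : prime q -> (exists e, Q = (q ^ e)%N) ->
    (forall m : 'I_k -> nat, (\sum_i m i <= N + r)%N ->
      (N%:Z %| \sum_i (m i)%:Z * al i)%Z ->
      (n%:Z %| \sum_i (m i)%:Z * be i)%Z ->
      (Q%:Z %| \sum_i (m i)%:Z * th i)%Z) ->
  forall m : 'I_k -> int, (N%:Z %| dot m al)%Z -> (n%:Z %| dot m be)%Z ->
    (Q%:Z %| dot m th)%Z.
Proof.
move=> q_prime Q_q short.
(* For q dividing n this is [good_triple]; otherwise the elimination below leaves only pairs, for
   which [good_pair] suffices. *)
have tgood i j h (x y z : int) : (q %| n)%N \/ z = 0 ->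
    (N%:Z %| lin3 (al i) (al j) (al h) x y z)%Z ->
    (n%:Z %| lin3 (be i) (be j) (be h) x y z)%Z ->
    (Q%:Z %| lin3 (th i) (th j) (th h) x y z)%Z.
  move=> qz La Lb.
  have sh (u v w : int) : 0 <= u -> 0 <= v -> 0 <= w ->
      u + v + w <= (N + r)%N ->
      (N%:Z %| lin3 (al i) (al j) (al h) u v w)%Z /\
      (n%:Z %| lin3 (be i) (be j) (be h) u v w)%Z ->
      (Q%:Z %| lin3 (th i) (th j) (th h) u v w)%Z.
    case: u => // u _; case: v => // v _; case: w => // w _ le [La' Lb'].
    pose m s := (u * (s == i) + v * (s == j) + w * (s == h))%N.
    have Em (c : 'I_k -> int) :
        \sum_s (m s)%:Z * c s = lin3 (c i) (c j) (c h) u v w.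
      by rewrite -dot_triple; apply: eq_bigr => s _; rewrite /m !PoszD !PoszM.
    rewrite -Em; apply: short; rewrite ?Em //.
    have sum1 (a : nat) (i0 : 'I_k) : (\sum_s a * (s == i0) = a)%N.
      rewrite (bigD1 i0) //= eqxx muln1 big1 ?addn0 // => s /negPf->.
      by rewrite muln0.
    by rewrite /m !big_split /= !sum1 -lez_nat !PoszD; move: le; rewrite PoszD.
  case: qz => [qn|z0].
    by apply: (good_triple q_prime qn) sh _ _ _ _ => //; exact: le_r.
  by apply: good_pair sh _ _ _ _ _ => //; right; right.
move=> m La Lb.
case: k al be th dot_triple short tgood m La Lb =>
  [|k'] al' be' th' dott short tgood m La Lb.
  by rewrite big_ord0 dvdz0.
(* Elimination at q: i1 clears the al modulo the q-part of N, then i2 clears the corrected [be2]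
   modulo the q-part of n. If q does not divide n, that part is 1 and y = 0 works. *)
have [i1 [z zP]] := exists_min_valuation al' (logn q N) q_prime.
pose be2 i := be' i - z i * be' i1.
have [i2 [y [yP qy]]] : exists i2, exists y : 'I_k'.+1 -> int,
    (forall i, ((q ^ logn q n)%N%:Z %| be2 i - y i * be2 i2)%Z) /\
    ((q %| n)%N \/ forall i, y i = 0).
  have [qn|qn] := boolP (q %| n)%N.
    have [i2 [y yP]] := exists_min_valuation be2 (logn q n) q_prime.
    by exists i2, y; split=> //; left.
  exists i1, (fun=> 0); split; last by right.
  by move=> i; rewrite lognE (negPf qn) !andbF expn0 dvd1z.
have n_gt0 : (0 < n)%N by apply: dvdn_gt0 n_N.
(* [c] is prime to q and kills the prime-to-q parts of Z/N and Z/n, hence     *)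
(* c (al i, be i) is a combination of the characters with indices i1 and i2.  *)
pose c := (N`_q^' * n`_q^')%N.
have qc : coprimez Q c.
  case: Q_q => e ->; rewrite coprimezE /=; apply: coprimeXl;
    rewrite prime_coprime //.
  by rewrite Euclid_dvdM // negb_or -!p'natE // !part_pnat.
pose a i := z i - y i * z i2.
have part_dvd (M : nat) X : (0 < M)%N -> ((q ^ logn q M)%N%:Z %| X)%Z ->
    (M%:Z %| (M`_q^')%:Z * X)%Z.
  move=> M0 H; have := dvdz_mul (dvdzz (M`_q^')%N%:Z) H.
  by rewrite -PoszM -p_part mulnC partnC.
have alP i : (N%:Z %| c%:Z * (al' i - a i * al' i1 - y i * al' i2))%Z.
  have -> : c%:Z * (al' i - a i * al' i1 - y i * al' i2) =
     (N`_q^')%:Z * ((al' i - z i * al' i1) - y i * (al' i2 - z i2 * al' i1))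
       * (n`_q^')%:Z.
    by rewrite /c /a PoszM; ring.
  apply: dvdz_mulr; apply: part_dvd => //; apply: rpredB; first exact: zP.
  by apply: dvdz_mull; exact: zP.
have beP i : (n%:Z %| c%:Z * (be' i - a i * be' i1 - y i * be' i2))%Z.
  have -> : c%:Z * (be' i - a i * be' i1 - y i * be' i2) =
     (n`_q^')%:Z * (be2 i - y i * be2 i2) * (N`_q^')%:Z.
    by rewrite /c /a /be2 PoszM; ring.
  by apply: dvdz_mulr; apply: part_dvd.
have E C i : lin3 (C i) (C i1) (C i2) c (- (c%:Z * a i)) (- (c%:Z * y i)) =
   c%:Z * (C i - a i * C i1 - y i * C i2) by rewrite /lin3; ring.
have thP i : (Q%:Z %| c%:Z * (th' i - a i * th' i1 - y i * th' i2))%Z.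
  rewrite -E; apply: tgood; rewrite ?E //.
  by case: qy => [|y0]; [left|right; rewrite y0 mulr0 oppr0].
(* c m is a combination of the three-index points treated above plus a point on i1 and i2 only; i2
   is repeated with coefficient 0 to fit the format of [tgood]. *)
have split_dot C : c%:Z * dot m C =
    \sum_i m i * (c%:Z * (C i - a i * C i1 - y i * C i2)) +
    lin3 (C i1) (C i2) (C i2) (c%:Z * dot m a) (c%:Z * dot m y) 0.
  rewrite /lin3 mul0r addr0 !mulr_sumr !mulr_suml -!big_split /=.
  by apply: eq_bigr => i _; ring.
have lin_dvd d (C : 'I_k'.+1 -> int) :
    (forall i, (d %| c%:Z * (C i - a i * C i1 - y i * C i2))%Z) ->
    (d %| \sum_i m i * (c%:Z * (C i - a i * C i1 - y i * C i2)))%Z.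
  by move=> H; apply: rpred_sum => i _; apply: dvdz_mull.
have rest d (C : 'I_k'.+1 -> int) :
    (forall i, (d %| c%:Z * (C i - a i * C i1 - y i * C i2))%Z) ->
    (d %| dot m C)%Z ->
    (d %| lin3 (C i1) (C i2) (C i2) (c%:Z * dot m a) (c%:Z * dot m y) 0)%Z.
  by move=> /lin_dvd H dC; rewrite -(rpredDl _ H) -split_dot dvdz_mull.
rewrite -(Gauss_dvdzr _ qc) split_dot; apply: rpredD; first exact: lin_dvd.
by apply: tgood; [right|apply: rest..].
Qed.

(** Glues the results at the primes q dividing N: N divides an integer as soon as all its primary
    parts do. *)
Lemma family_good :
    (forall m : 'I_k -> nat, (\sum_i m i <= N + r)%N ->
      (N%:Z %| \sum_i (m i)%:Z * al i)%Z ->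
      (n%:Z %| \sum_i (m i)%:Z * be i)%Z ->
      (N%:Z %| \sum_i (m i)%:Z * th i)%Z) ->
  forall m : 'I_k -> int, (N%:Z %| dot m al)%Z -> (n%:Z %| dot m be)%Z ->
    (N%:Z %| dot m th)%Z.
Proof.
move=> short m La Lb; rewrite dvdzE; apply/dvdn_partP => // q.
rewrite mem_primes => /andP[q_prime _].
apply: (family_good_prime q_prime (Q := N`_q)) La Lb.
  by exists (logn q N); rewrite p_part.
move=> m' le La Lb; apply: dvdz_trans (short m' le La Lb).
by rewrite dvdzE dvdn_part.
Qed.
End Family.

(** * Duality of modules over Z/N *)

Lemma extend_hom_mod k (P : ('I_k -> int) -> Prop) (f g : ('I_k -> int) -> int)
    (N : nat) :
    (0 < N)%N -> P (fun=> 0) ->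
    (forall m m' (c : int), P m -> P m' -> P (fun i => m i - c * m' i)) ->
    (forall m m' (c : int), f (fun i => m i - c * m' i) = f m - c * f m') ->
    (forall m m' (c : int), g (fun i => m i - c * m' i) = g m - c * g m') ->
    (forall m, P m -> (N%:Z %| f m)%Z -> (N%:Z %| g m)%Z) ->
  exists s : int, forall m, P m -> (N%:Z %| g m - s * f m)%Z.
Proof.
move=> N0 P0 PB fB gB fg.
pose I x := exists2 m, P m & (N%:Z %| x - f m)%Z.
have zero (h : ('I_k -> int) -> int) :
    (forall m m' (c : int), h (fun i => m i - c * m' i) = h m - c * h m') ->
      h (fun=> 0) = 0.
  move=> hB; have -> : (fun=> 0) = (fun=> 0 - 1 * 0) :> ('I_k -> int).
    by apply/funext => i; rewrite mulr0 subr0.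
  by rewrite (hB (fun=> 0) (fun=> 0)) mul1r subrr.
have f0 := zero f fB; have g0 := zero g gB.
(* f(P) + N Z = a Z, with a attained at m0 modulo N; the scalar s will be g m0 / a. *)
have [||a [a0 [m0 Pm0 am0] aP]] := @int_subgroup_gen I N N0.
- by exists (fun=> 0) => //; rewrite f0 subr0.
- move=> x y [m Pm xm] [m' Pm' ym']; exists (fun i => m i - 1 * m' i);
  first exact: PB.
  rewrite fB mul1r; have -> : x - y - (f m - f m') = (x - f m) - (y - f m').
    by ring.
  exact: rpredB.
have [M EN] : exists M, N = (M * a)%N.
  by apply/dvdnP; apply: (aP N%:Z); exists (fun=> 0); rewrite // f0 subr0.
have zero_comb c m1 : P m1 -> (N%:Z %| f m1 - c * f m0)%Z ->
  (N%:Z %| g m1 - c * g m0)%Z.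
  by move=> Pm; rewrite -fB -gB; apply: fg; apply: PB.
(* With N = M a, f sends M m0 into N Z, hence so does g; thus M a divides M (g m0). *)
have /dvdzP[s Es] : (a%:Z %| g m0)%Z.
  have M0 : M%:Z != 0.
    by rewrite eqz_nat -lt0n; move: N0; rewrite EN muln_gt0 => /andP[].
  have Nf : (N%:Z %| M%:Z * f m0)%Z.
    have -> : M%:Z * f m0 = N%:Z - M%:Z * (a%:Z - f m0).
      by rewrite EN PoszM; ring.
    by apply: rpredB; rewrite ?dvdzz ?dvdz_mull.
  have := zero_comb M%:Z (fun=> 0) P0; rewrite f0 g0 !sub0r !rpredN => /(_ Nf).
  by rewrite EN PoszM dvdz_mul2l.
exists s => m Pm.
have /aP/dvdzP[j Ej] : I (f m) by exists m; rewrite ?subrr.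
have H : (N%:Z %| f m - j * f m0)%Z by rewrite Ej -mulrBr dvdz_mull.
have -> : g m - s * f m = g m - j * g m0 by rewrite Ej Es; ring.
exact: zero_comb.
Qed.

(** Two extensions: along f2 on the kernel of f1 mod N, which gives t, then along f1 for g - t f2 on
    all of Z^k, which gives s. Basis vectors recover the coordinates. *)
Lemma duality_mod k (f1 f2 g : 'I_k -> int) (N : nat) : (0 < N)%N ->
    (forall m : 'I_k -> int, (N%:Z %| \sum_i m i * f1 i)%Z ->
      (N%:Z %| \sum_i m i * f2 i)%Z -> (N%:Z %| \sum_i m i * g i)%Z) ->
  exists s t : int, forall i, (N%:Z %| g i - s * f1 i - t * f2 i)%Z.
Proof.
move=> N0 H; pose dot c m : int := \sum_(i < k) m i * c i.
have dotB c m m' a : dot c (fun i => m i - a * m' i) = dot c m - a * dot c m'.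
  by rewrite /dot mulr_sumr -sumrB; apply: eq_bigr => i _; rewrite mulrBl mulrA.
have dot0 c : dot c (fun=> 0) = 0.
  by rewrite /dot big1 // => i _; rewrite mul0r.
have [|m m' c Pm Pm'|t tP] := @extend_hom_mod k (fun m => (N%:Z %| dot f1 m)%Z)
  (dot f2) (dot g) N N0 _ _ (dotB f2) (dotB g) H.
- by rewrite dot0.
- by rewrite dotB; apply: rpredB => //; apply: dvdz_mull.
have [] // := @extend_hom_mod k (fun=> True) (dot f1)
  (dot (fun i => g i - t * f2 i)) N N0 I _ (dotB f1) (dotB _) _.
- move=> m _ /tP; congr (_ %| _)%Z; rewrite /dot mulr_sumr -sumrB.
  by apply: eq_bigr => i _; ring.
move=> s sP; exists s, t => i.
have := sP (fun j => (j == i)%:Z) Logic.I.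
have E c : dot c (fun j => (j == i)%:Z) = c i.
  rewrite /dot (bigD1 i) //= eqxx mul1r big1 ?addr0 // => j /negPf->.
  by rewrite mul0r.
by rewrite !E; congr (_ %| _)%Z; ring.
Qed.

(** * From lattice relations to group orbits *)

Lemma sumPosz k (f : 'I_k -> nat) : (\sum_i f i)%N%:Z = \sum_i (f i)%:Z.
Proof. exact: (big_morph Posz PoszD erefl). Qed.

Lemma exists_nat_congruent (N : nat) (x : int) : (0 < N)%N ->
  exists a : nat, (N%:Z %| x - a%:Z)%Z.
Proof.
move=> N0; exists `|(x %% N)%Z|%N;
  rewrite gez0_abs ?modz_ge0 ?eqz_nat -?lt0n //.
by rewrite /modz opprB addrCA subrr addr0 dvdz_mull.
Qed.

Lemma torus_separation (F : fieldType) (l n r k : nat) (z : F)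
    (al be : 'I_k -> nat) (v w : 'I_k -> F) :
    (0 < l)%N -> (0 < n)%N -> (l * n).-primitive_root z ->
    (forall q, prime q -> (q %| n)%N -> (n %/ q <= r)%N) ->
    (forall m : 'I_k -> nat, (\sum_i m i <= l * n + r)%N ->
      (l * n %| \sum_i m i * al i)%N -> (n %| \sum_i m i * be i)%N ->
      \prod_i v i ^+ m i = \prod_i w i ^+ m i) ->
  exists s t : nat, forall i, w i = z ^+ (s * al i + t * (l * be i)) * v i.
Proof.
move=> l0 n0 prim_z le_r sep; set N := (l * n)%N in prim_z sep *.
have N0 : (0 < N)%N by rewrite muln_gt0 l0.
have nN : (n %| N)%N by rewrite dvdn_mull.
(* The N-th power of a coordinate is a short invariant, so the ratio of the coordinates of w and v
   is an N-th root of unity wherever v is nonzero. *)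
have powN i : v i ^+ N = w i ^+ N.
  pose m j := (N * (j == i))%N.
  have prod_m (u : 'I_k -> F) : \prod_j u j ^+ m j = u i ^+ N.
    rewrite (bigD1 i) //= /m eqxx muln1 big1 ?mulr1 // => j /negPf->.
    by rewrite muln0 expr0.
  rewrite -!prod_m; apply: sep.
  - rewrite (bigD1 i) //= /m eqxx muln1 big1 ?addn0 ?leq_addr // => j /negPf->.
    by rewrite muln0.
  - by apply: dvdn_sum => j _; rewrite -mulnA dvdn_mulr.
  - by apply: dvdn_sum => j _; rewrite -mulnA dvdn_mulr.
have w0 i : v i = 0 -> w i = 0.
  by move=> v0; apply/eqP; move/eqP: (powN i);
    rewrite v0 expr0n gtn_eqF // eq_sym expf_eq0 N0.
have thP_ex i : exists a, w i = z ^+ a * v i.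
  have [v0|v0] := eqVneq (v i) 0.
    by exists 0%N; rewrite w0 // v0 mulr0.
  have [|a Ea] := prim_rootP prim_z (x := w i / v i).
    by rewrite expr_div_n powN divff // -powN expf_neq0.
  by exists a; rewrite -Ea divfK.
have [th thP] := choice thP_ex.
(* The coordinates where v and w vanish carry no information. *)
pose cut (c : 'I_k -> nat) i := if v i == 0 then 0%N else c i.
have cutE (m c : 'I_k -> nat) :
    \sum_i (m i)%:Z * (cut c i)%:Z = (\sum_i cut m i * c i)%N%:Z.
  by rewrite sumPosz; apply: eq_bigr => i _; rewrite -PoszM /cut; case: ifP;
    rewrite ?muln0.
have good := @family_good N n r k (fun i => (cut al i)%:Z)
  (fun i => (cut be i)%:Z) (fun i => (cut th i)%:Z) N0 nN le_r.
(* The condition mod n on be is rescaled to one mod N on l be, so that duality applies with a single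
   modulus. *)
have {}good (m : 'I_k -> int) : (N%:Z %| \sum_i m i * (cut al i)%:Z)%Z ->
    (N%:Z %| \sum_i m i * (l * cut be i)%N%:Z)%Z ->
    (N%:Z %| \sum_i m i * (cut th i)%:Z)%Z.
  move=> La Lb; apply: good => [{La Lb}m' le La Lb|//|].
    rewrite cutE dvdzE /= (prim_order_dvd prim_z).
    (* Exponents of vanishing coordinates are dropped: the monomial stays short and is nonzero at v,
       so it can be cancelled. *)
    have prod_neq0 : \prod_i v i ^+ cut m' i != 0.
      rewrite prodf_seq_neq0; apply/allP => i _ /=; rewrite /cut.
      by case: ifP => [_|/negbT]; [rewrite expr0 oner_neq0|exact: expf_neq0].
    rewrite -(inj_eq (mulIf prod_neq0)) mul1r; apply/eqP.
    rewrite [RHS]sep.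
    - rewrite expr_sum -big_split /=; apply: eq_bigr => i _.
      by rewrite thP exprMn -exprM mulnC.
    - apply: leq_trans le; apply: leq_sum => i _; rewrite /cut.
      by case: ifP.
    - by rewrite cutE in La.
    - by rewrite cutE in Lb.
  have l_neq0 : l%:Z != 0 by rewrite eqz_nat -lt0n.
  rewrite -(dvdz_mul2l l_neq0) -PoszM mulr_sumr.
  move: Lb; congr (_ %| _)%Z; apply: eq_bigr => i _; rewrite PoszM; ring.
have [s [t stP]] := duality_mod N0 good.
have [s' sP] := exists_nat_congruent s N0.
have [t' tP] := exists_nat_congruent t N0.
exists s', t' => i.
have [v0|v0] := eqVneq (v i) 0; first by rewrite w0 // v0 mulr0.
rewrite thP; congr (_ * _); apply/eqP; rewrite (eq_prim_root_expr prim_z).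
rewrite -eqz_nat -!modz_nat eqz_mod_dvd.
have := stP i; rewrite /cut (negPf v0) => stPi.
have -> : (th i)%:Z - (s' * al i + t' * (l * be i))%N%:Z =
  ((th i)%:Z - s * (al i)%:Z - t * (l * be i)%N%:Z) +
  ((s - s'%:Z) * (al i)%:Z + (t - t'%:Z) * (l * be i)%N%:Z).
  by rewrite PoszD !PoszM; ring.
by apply: rpredD => //; apply: rpredD; apply: dvdz_mulr.
Qed.

(** * Diagonalization for two commuting generators *)

Lemma closed_prim_root (C : numClosedFieldType) (N : nat) : (0 < N)%N ->
  exists z : C, N.-primitive_root z.
Proof.
move=> N0; have [rs Ers] := closed_field_poly_normal ('X^N - 1 : {poly C}).
rewrite (monicP (monicXnsubC _ N0)) scale1r in Ers.
have uniq_rs : uniq rs.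
  by rewrite -separable_prod_XsubC -Ers separable_Xn_sub_1 // pnatr_eq0 -lt0n.
have root_rs : all N.-unity_root rs.
  by apply/allP => x; rewrite -root_prod_XsubC -Ers.
have size_rs : (N <= size rs)%N.
  by rewrite -ltnS -(size_prod_XsubC rs id) -Ers size_XnsubC.
by have /hasP[z _ prim_z] := has_prim_root N0 root_rs uniq_rs size_rs; exists z.
Qed.

(** The matrix is killed by X^#[x] - 1, which has distinct roots. *)
Lemma diagonalizable_repr (C : numClosedFieldType) (gT : finGroupType)
    (G : {group gT}) k (rG : mx_representation C G k) x :
  x \in G -> diagonalizable (rG x).
Proof.
case: k rG => [|k] rG Gx.
  by exists 1%:M; rewrite ?unitmx1 //; apply/is_diag_mxP => -[].
apply/diagonalizableP; have N0 := order_gt0 x.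
have [rs Ers] := closed_field_poly_normal ('X^(#[x]%g) - 1 : {poly C}).
rewrite (monicP (monicXnsubC _ N0)) scale1r in Ers.
exists rs.
  by rewrite -separable_prod_XsubC -Ers separable_Xn_sub_1 // pnatr_eq0 -lt0n.
rewrite -Ers; apply: mxminpoly_min.
have repr_expg m : rG (x ^+ m)%g = rG x ^+ m.
  elim: m => [|m IH]; first by rewrite expg0 repr_mx1 expr0.
  by rewrite expgS repr_mxM ?groupX // IH exprS.
by rewrite rmorphB rmorphXn /=
  horner_mx_X horner_mx_C -repr_expg expg_order repr_mx1 subrr.
Qed.

Lemma codiagonalizable_repr2 (C : numClosedFieldType) (gT : finGroupType)
    (G : {group gT}) k (rG : mx_representation C G k) x y :
    x \in G -> y \in G -> commute x y ->
  exists2 P, P \in unitmx & exists d e : 'rV_k,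
    forall s t, P *m rG (x ^+ s * y ^+ t)%g =
      diag_mx (\row_i (d 0 i ^+ s * e 0 i ^+ t)) *m P.
Proof.
move=> Gx Gy cxy.
have comm_xy : comm_mx (rG x) (rG y) by rewrite /comm_mx -!repr_mxM // cxy.
have [] := @codiagonalizableP _ _ [:: rG x; rG y]; case.
  split=> [A B|A].
    by rewrite !inE => /orP[] /eqP-> /orP[] /eqP-> //; rewrite /comm_mx comm_xy.
  by rewrite !inE => /orP[] /eqP->; apply: diagonalizable_repr.
move=> P Pu /and3P[/similar_diagPex[d Ed] /similar_diagPex[e Ee] _] _.
have {}Ed := elimT (similarP Pu) Ed; have {}Ee := elimT (similarP Pu) Ee.
exists P => //; exists d, e.
have expE (u : gT) (c : 'rV_k) m : u \in G -> P *m rG u = diag_mx c *m P ->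
    P *m rG (u ^+ m)%g = diag_mx (\row_i c 0 i ^+ m) *m P.
  move=> Gu Eu; elim: m => [|m IH].
    rewrite expg0 repr_mx1 mulmx1; suff -> : \row_i c 0 i ^+ 0 = const_mx 1.
      by rewrite diag_const_mx mul1mx.
    by apply/rowP => i; rewrite !mxE expr0.
  rewrite expgSr repr_mxM ?groupX // mulmxA IH -mulmxA Eu mulmxA mulmx_diag.
  by congr (diag_mx _ *m P); apply/rowP => i; rewrite !mxE exprSr.
move=> s t; rewrite repr_mxM ?groupX // mulmxA (expE _ _ _ Gx Ed) -mulmxA.
rewrite (expE _ _ _ Gy Ee) mulmxA mulmx_diag.
by congr (diag_mx _ *m P); apply/rowP => i; rewrite !mxE.
Qed.

Lemma dhomog_prod_exp (C : comNzRingType) k (f : 'I_k -> {mpoly C[k]})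
    (m : 'I_k -> nat) :
  (forall i, f i \is 1.-homog) -> \prod_i f i ^+ m i \is (\sum_i m i).-homog.
Proof.
move=> hf; elim/big_rec2: _ => [|i d p _ hp]; first exact: dhomog1.
apply: dhomogM => //.
by have : f i ^+ m i \is (1 * m i).-homog; [exact: dhomogMn | rewrite mul1n].
Qed.

Lemma separating_degree_rank2 (R : realType) (gT : finGroupType)
    (G : {group gT}) k (rG : mx_representation R[i] G k)
    (l n r : nat) (x y : gT) :
    (0 < l)%N -> (0 < n)%N ->
    (forall q, prime q -> (q %| n)%N -> (n %/ q <= r)%N) ->
    x \in G -> y \in G -> commute x y ->
    (x ^+ (l * n) = 1)%g -> (y ^+ n = 1)%g ->
    (forall g, g \in G -> exists s t, g = (x ^+ s * y ^+ t)%g) ->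
  separating_degree rG (l * n + r).
Proof.
move=> l0 n0 le_r Gx Gy cxy xN yn genG v w neq_vw.
have N0 : (0 < l * n)%N by rewrite muln_gt0 l0.
have [z prim_z] := closed_prim_root R[i] N0.
have prim_zl : n.-primitive_root (z ^+ l).
  by have := dvdn_prim_root prim_z (dvdn_mull l (dvdnn n)); rewrite mulnK.
have [P Pu [d [e dP]]] := codiagonalizable_repr2 rG Gx Gy cxy.
have diag1 (c : 'rV[R[i]]_k) : diag_mx c *m P = P -> forall i, c 0 i = 1.
  move=> E i; have : diag_mx c = 1%:M by rewrite -[LHS](mulmxK Pu) E mulmxV.
  by move/matrixP/(_ i i); rewrite !mxE eqxx.
have [al alP] : exists al : 'I_k -> nat, forall i, d 0 i = z ^+ al i.
  suff /choice[al alP] : forall i, exists a, d 0 i = z ^+ a by exists al.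
  move=> i; have [|a Ea] := prim_rootP prim_z (x := d 0 i); last by exists a.
  have := dP (l * n)%N 0%N; rewrite xN expg0 mulg1 repr_mx1 mulmx1.
  by move/esym/diag1/(_ i); rewrite mxE expr0 mulr1.
have [be beP] : exists be : 'I_k -> nat, forall i, e 0 i = z ^+ (l * be i).
  suff /choice[be beP] : forall i, exists a, e 0 i = z ^+ (l * a) by exists be.
  move=> i; have [|a Ea] := prim_rootP prim_zl (x := e 0 i).
    have := dP 0%N n; rewrite yn expg0 mulg1 repr_mx1 mulmx1.
    by move/esym/diag1/(_ i); rewrite mxE expr0 mul1r.
  by exists a; rewrite Ea exprM.
have {}dP s t u i : (P *m (rG (x ^+ s * y ^+ t)%g *m u)) i 0 =
    z ^+ (s * al i + t * (l * be i)) * (P *m u) i 0 :> R[i].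
  rewrite mulmxA dP -mulmxA mul_diag_mx !mxE alP beP -!exprM -exprD.
  by rewrite [(al i * s)%N]mulnC [(_ * t)%N]mulnC.
(* Monomials in the eigencoordinates, the entries of P u, expressed in the original variables. *)
pose f m : {mpoly R[i][k]} := \prod_i (\sum_j P i j *: 'X_j) ^+ m i.
have fE m u : evalV (f m) u = \prod_i (P *m u) i 0 ^+ m i.
  rewrite /evalV /f rmorph_prod /=; apply: eq_bigr => i _.
  rewrite rmorphXn /=; congr (_ ^+ _); rewrite raddf_sum /= [RHS]mxE.
  by apply: eq_bigr => j _; rewrite mevalZ mevalXU.
have f_homog m : f m \is (\sum_i m i).-homog.
  apply: dhomog_prod_exp => i; apply: rpred_sum => j _; apply: dhomogZ.
  by rewrite dhomogX /= mdeg1.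
have f_inv m : (l * n %| \sum_i m i * al i)%N -> (n %| \sum_i m i * be i)%N ->
    Defs.invariant rG (f m).
  move=> La Lb g u /genG[s [t ->]]; rewrite !fE.
  under eq_bigr do rewrite dP exprMn -exprM.
  rewrite big_split /= -expr_sum.
  have -> : (\sum_i (s * al i + t * (l * be i)) * m i =
      s * (\sum_i m i * al i) + t * (l * (\sum_i m i * be i)))%N.
    rewrite !big_distrr -big_split /=; apply: eq_bigr => i _.
    by rewrite mulnDl -!mulnA ![(m i * _)%N]mulnC.
  suff /eqP-> :
      z ^+ (s * (\sum_i m i * al i) + t * (l * (\sum_i m i * be i))) == 1.
    by rewrite mul1r.
  rewrite -(prim_order_dvd prim_z); apply: dvdn_add; first exact: dvdn_mull.
  by apply: dvdn_mull; rewrite dvdn_pmul2l.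
(* If no short invariant separates v from w, then no [f m] does, and [torus_separation] yields a
   group element carrying v to w. *)
apply: contrapT => nsep; apply: neq_vw.
have sep m : (\sum_i m i <= l * n + r)%N -> (l * n %| \sum_i m i * al i)%N ->
    (n %| \sum_i m i * be i)%N ->
    \prod_i (P *m v) i 0 ^+ m i = \prod_i (P *m w) i 0 ^+ m i.
  move=> le La Lb; rewrite -!fE; apply: contrapT => neq.
  by apply: nsep; exists (f m), (\sum_i m i)%N; split=> //; exact: f_inv.
have [s [t stP]] := torus_separation l0 n0 prim_z le_r sep.
have [g Gg Ew] : exists2 g, g \in G & w = rG g *m v.
  exists (x ^+ s * y ^+ t)%g; first by rewrite groupM ?groupX.
  by apply: (can_inj (mulKmx Pu)); apply/colP => i; rewrite [RHS]dP stP.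
apply/seteqP; split=> u [h Gh ->] /=.
  exists (h * g^-1)%g; first by rewrite groupM ?groupV.
  by rewrite Ew mulmxA -repr_mxM ?groupM ?groupV // mulgKV.
by exists (h * g)%g; rewrite ?groupM // Ew mulmxA repr_mxM.
Qed.

(** * Characters and diagonal representations *)

Lemma exists_linear_char (F : fieldType) (gT : finGroupType) (a : gT) (z : F) :
  #[a]%g.-primitive_root z ->
  exists chi : gT -> F, forall s, chi (a ^+ s)%g = z ^+ s.
Proof.
move=> prim_z; pose Q x u := forall s, x = (a ^+ s)%g -> u = z ^+ s.
suff /choice[chi chiP] : forall x, exists u, Q x u.
  by exists chi => s; apply: chiP.
(* On powers of a the value is well defined since z has order #[a]; elsewhere it is the default
   0. *)
move=> x; have [[s ->]|nx] := EM (exists s, x = (a ^+ s)%g).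
  exists (z ^+ s) => t /eqP; rewrite eq_expg_mod_order => st.
  by apply/eqP; rewrite (eq_prim_root_expr prim_z).
by exists 0 => s xs; case: nx; exists s.
Qed.

Lemma sum_char_eq0 (F : fieldType) (gT : finGroupType) (G : {group gT})
    (chi : gT -> F) h :
    {in G &, {morph chi : x y / (x * y)%g >-> x * y}} ->
    h \in G -> chi h != 1 ->
  \sum_(g in G) chi g = 0.
Proof.
move=> chiM Gh chih; have E : \sum_(g in G) chi g = chi h * \sum_(g in G) chi g.
  rewrite {1}(reindex_inj (mulgI h)) mulr_sumr /=.
  by apply: eq_big => [g|g Gg]; rewrite ?groupMl // chiM // -(groupMl _ Gh).
apply/eqP; move/eqP: E; rewrite -subr_eq0 -{1}[\sum_(_ in _) _]mul1r.
rewrite -mulrBl mulf_eq0.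
by rewrite subr_eq0 eq_sym (negPf chih).
Qed.

Section DiagonalRepresentation.
Variables (R : realType) (gT : finGroupType) (G : {group gT}) (k : nat).
Variable (c : gT -> 'I_k -> R[i]).
Hypothesis c1 : forall i, c 1%g i = 1.
Hypothesis cM : forall i, {in G &, {morph c^~ i : x y / (x * y)%g >-> x * y}}.

Lemma diag_mx_repr : mx_repr G (fun g => diag_mx (\row_i c g i)).
Proof.
split=> [|x y Gx Gy].
  suff -> : \row_i c 1%g i = const_mx 1 by rewrite diag_const_mx.
  by apply/rowP => i; rewrite !mxE c1.
by rewrite mulmx_diag; congr diag_mx; apply/rowP => i; rewrite !mxE cM.
Qed.

Local Notation rG := (MxRepresentation diag_mx_repr).

(* Averaging over G kills every monomial of f on which G acts nontrivially.  *)
Lemma evalV_diag_repr_eq (f : {mpoly R[i][k]}) (v w : 'cV[R[i]]_k) :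
    Defs.invariant rG f ->
    (forall m, m \in msupp f -> {in G, forall g, \prod_i c g i ^+ m i = 1} ->
      \prod_i v i 0 ^+ m i = \prod_i w i 0 ^+ m i) ->
  evalV f v = evalV f w.
Proof.
move=> f_inv vw.
have evalE u g : g \in G -> evalV f u = \sum_(m <- msupp f)
    f@_m * (\prod_i u i 0 ^+ m i * \prod_i c g i ^+ m i).
  move=> Gg; rewrite -(f_inv g u Gg) /evalV mevalE; apply: eq_bigr => m _.
  rewrite -big_split /=; congr (_ * _); apply: eq_bigr => i _.
  by rewrite mul_diag_mx !mxE exprMn mulrC.
have cardE u : #|G|%:R * evalV f u = \sum_(m <- msupp f)
    f@_m * (\prod_i u i 0 ^+ m i * \sum_(g in G) \prod_i c g i ^+ m i).
  rewrite mulr_natl -sumr_const (eq_bigr _ (evalE u)) exchange_big /=.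
  by apply: eq_bigr => m _; rewrite -!mulr_sumr.
have G_neq0 : #|G|%:R != 0 :> R[i] by rewrite pnatr_eq0 -lt0n cardG_gt0.
apply: (mulfI G_neq0); rewrite !cardE; apply: eq_big_seq => m fm; congr (_ * _).
have [triv|] := EM {in G, forall g, \prod_i c g i ^+ m i = 1}.
  by rewrite vw.
move=> /existsNP[h /not_implyP[Gh /eqP neq]].
rewrite (@sum_char_eq0 _ _ G (fun g => \prod_i c g i ^+ m i) h) ?mulr0 //.
move=> x y Gx Gy /=; rewrite -big_split /=; apply: eq_bigr => i _.
by rewrite cM // exprMn.
Qed.
End DiagonalRepresentation.

(** * Upper and lower bounds for a product of two cyclic groups *)

Lemma lower_weight (l n p m0 m1 m2 : nat) : (0 < l)%N -> (0 < n)%N -> prime p ->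
    (p %| n)%N -> (l * n %| m0 + m2)%N -> (n %| m1 + (n - n %/ p) * m2)%N ->
    (m0 + m1 + m2 < l * n + n %/ p)%N -> (p %| m2)%N.
Proof.
move=> l0 n0 p_prime pn d1 d2 lt; apply/negPn/negP => pm2.
(* As m2 > 0, l n <= m0 + m2, which leaves m1 < n/p. But n/p divides m1, so m1 = 0, and then n
   divides (n/p) m2, forcing p to divide m2. *)
have m2_gt0 : (0 < m2)%N by case: m2 pm2 {d1 d2 lt}; rewrite ?dvdn0.
have le1 : (l * n <= m0 + m2)%N by rewrite dvdn_leq // addn_gt0 m2_gt0 orbT.
have m1_lt : (m1 < n %/ p)%N.
  by rewrite -(ltn_add2l (l * n)); apply: leq_ltn_trans lt;
    rewrite addnAC leq_add2r.
have np0 : (0 < n %/ p)%N by rewrite divn_gt0 ?prime_gt0 // dvdn_leq.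
have np_n : (n %/ p %| n)%N by rewrite dvdn_div.
have m1_0 : m1 = 0%N.
  apply/eqP; apply: contraTT m1_lt; rewrite -lt0n -leqNgt => m10.
  apply: dvdn_leq => //; have := dvdn_trans np_n d2.
  by rewrite dvdn_addl // dvdn_mulr // dvdn_sub.
move: d2; rewrite m1_0 add0n mulnBl dvdn_subr ?leq_mul2r ?leq_div ?orbT //;
  last exact: dvdn_mulr.
by rewrite -{1}(divnK pn) dvdn_pmul2l // (negPf pm2).
Qed.

Section Main.
Variables (R : realType) (l n : nat) (gT1 gT2 : finGroupType).
Variables (A : {group gT1}) (B : {group gT2}) (a : gT1) (b : gT2).
Hypotheses (l_gt0 : (0 < l)%N) (n_gt1 : (1 < n)%N).
Hypotheses (defA : A :=: <[a]>%g) (defB : B :=: <[b]>%g).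
Hypotheses (cardA : #|A| = (l * n)%N) (cardB : #|B| = n).
Let n_gt0 : (0 < n)%N := ltnW n_gt1.
Let G := setX_group A B.

Lemma expg_pair (x : gT1) (y : gT2) s t :
  ((x, 1) ^+ s * (1, y) ^+ t = (x ^+ s, y ^+ t) :> gT1 * gT2)%g.
Proof.
have E1 : ((x, 1) ^+ s = (x ^+ s, 1) :> gT1 * gT2)%g.
  by elim: s => // s IH; rewrite !expgS IH; congr pair; rewrite mulg1.
have E2 : ((1, y) ^+ t = (1, y ^+ t) :> gT1 * gT2)%g.
  by elim: t => // t IH; rewrite !expgS IH; congr pair; rewrite mulg1.
by rewrite E1 E2; congr pair; rewrite ?mul1g ?mulg1.
Qed.

Lemma setX_cyclicP g : reflect (exists s t, g = (a ^+ s, b ^+ t)%g) (g \in G).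
Proof.
case: g => x y; rewrite inE /= defA defB.
apply: (iffP andP) => [[/cycleP[s ->] /cycleP[t ->]]|[s [t [-> ->]]]].
  by exists s, t.
by rewrite !mem_cycle.
Qed.

Lemma beta_sep_mod_upper k (rG : mx_representation R[i] G k) :
  (beta_sep_mod rG <= l * n + n %/ pdiv n)%N.
Proof.
rewrite /beta_sep_mod; case: ex_minnP => d _; apply.
rewrite addn_gt0 muln_gt0 l_gt0 n_gt0 /=; apply/asboolP.
apply: (@separating_degree_rank2 _ _ _ _ _ l n _ (a, 1%g) (1%g, b)) => //.
- move=> q q_prime qn; apply: leq_div2l; first exact: pdiv_gt0.
  by rewrite pdiv_min_dvd // prime_gt1.
- by apply/setX_cyclicP; exists 1%N, 0%N; rewrite expg1 expg0.
- by apply/setX_cyclicP; exists 0%N, 1%N; rewrite expg1 expg0.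
- by rewrite /commute; congr pair; rewrite /= ?mulg1 ?mul1g.
- have := expg_pair a b (l * n) 0; rewrite !expg0 mulg1 => ->.
  by rewrite -cardA defA expg_order.
- have := expg_pair a b 0 n; rewrite !expg0 mul1g => ->.
  by rewrite -cardB defB expg_order.
- by move=> g /setX_cyclicP[s [t ->]]; exists s, t; rewrite expg_pair.
Qed.

Lemma beta_sep_mod_lower : exists k (rG : mx_representation R[i] G k),
  (l * n + n %/ pdiv n <= beta_sep_mod rG)%N.
Proof.
set p := pdiv n; have p_prime : prime p := pdiv_prime n_gt1.
have pn : (p %| n)%N := pdiv_dvd n.
have oa : #[a]%g = (l * n)%N by rewrite -cardA defA.
have ob : #[b]%g = n by rewrite -cardB defB.
have [z prim_z] := closed_prim_root R[i] (order_gt0 a).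
have [y prim_y] := closed_prim_root R[i] (order_gt0 b).
have [chi chiE] := exists_linear_char prim_z.
have [psi psiE] := exists_linear_char prim_y.
(* The exponent n - n/p stands for - n/p modulo n, so the third character is e1 - (n/p) e2. *)
pose c (g : gT1 * gT2) (i : 'I_3) : R[i] :=
  [tuple chi g.1; psi g.2; chi g.1 * psi g.2 ^+ (n - n %/ p)]`_i.
have c1 i : c 1%g i = 1.
  have chi1 : chi 1%g = 1 by rewrite -(expg0 a) chiE expr0.
  have psi1 : psi 1%g = 1 by rewrite -(expg0 b) psiE expr0.
  by case: i => [[|[|[|i]]]] ? //=; rewrite /c /= ?chi1 ?psi1 ?expr1n ?mul1r.
have cM i : {in G &, {morph c^~ i : g h / (g * h)%g >-> g * h}}.
  move=> g h /setX_cyclicP[s [t ->]] /setX_cyclicP[s' [t' ->]].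
  have chiM : chi (a ^+ s * a ^+ s')%g = chi (a ^+ s)%g * chi (a ^+ s')%g.
    by rewrite -expgD !chiE exprD.
  have psiM : psi (b ^+ t * b ^+ t')%g = psi (b ^+ t)%g * psi (b ^+ t')%g.
    by rewrite -expgD !psiE exprD.
  case: i => [[|[|[|i]]]] ? //=; rewrite /c /= ?chiM ?psiM // exprMn.
  by rewrite mulrACA.
pose rG := MxRepresentation (diag_mx_repr c1 cM).
exists 3%N, rG; rewrite /beta_sep_mod.
case: ex_minnP => d /andP[_ /asboolP sepd] _.
rewrite leqNgt; apply/negP => d_lt.
pose eta := z ^+ (l * n %/ p).
have pN : (p %| #[a]%g)%N by rewrite oa dvdn_mull.
have prim_eta : p.-primitive_root eta.
  by rewrite /eta -oa; apply: dvdn_prim_root.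
pose v : 'cV[R[i]]_3 := const_mx 1.
pose w : 'cV[R[i]]_3 := \col_i [tuple 1; 1; eta]`_i.
(* If g carries v to w, the first two coordinates force both characters to be 1 at g, and the third
   then gives eta = 1. *)
have neq_vw : orbitV rG v <> orbitV rG w.
  move=> E; have : orbitV rG w w.
    by exists 1%g; rewrite ?group1 // repr_mx1 mul1mx.
  rewrite -E => -[g Gg /colP Ew].
  have {}Ew (i : 'I_3) : [tuple 1; 1; eta]`_i = c g i :> R[i].
    by have := Ew i; rewrite /= mul_diag_mx !mxE mulr1.
  have := Ew (@Ordinal 3 2 isT); have := Ew (@Ordinal 3 1 isT).
  have := Ew (@Ordinal 3 0 isT); rewrite /c /= => <- <-; rewrite expr1n mulr1.
  move=> eta1; have := prim_order_dvd prim_eta 1; rewrite expr1 eta1 eqxx dvdn1.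
  by move/eqP=> p1; rewrite p1 in p_prime.
have [f [e [f_inv f_homog le_ed]]] := sepd v w neq_vw; apply.
apply: (evalV_diag_repr_eq f_inv) => m fm triv.
have prod3 (u : 'I_3 -> R[i]) : \prod_i u i = u (@Ordinal 3 0 isT) *
    u (@Ordinal 3 1 isT) * u (@Ordinal 3 2 isT).
  rewrite !big_ord_recr big_ord0 /= mul1r; congr (_ * _ * _); congr u;
    exact: val_inj.
set m0 := m (@Ordinal 3 0 isT); set m1 := m (@Ordinal 3 1 isT).
set m2 := m (@Ordinal 3 2 isT).
have deg_m : (m0 + m1 + m2 = e)%N.
  transitivity (mdeg m); last exact: (dhomog_mf f_homog fm).
  rewrite mdegE !big_ord_recr big_ord0 /= add0n.
  by congr (m _ + m _ + m _)%N; exact: val_inj.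
(* The monomial is 1 at v and eta^m2 at w, so p must divide m2. The congruences for [lower_weight]
   come from [triv] at the generators (a, 1) and (1, b). *)
rewrite !prod3 /v /w !mxE /= !expr1n !mul1r -/m2; apply/esym/eqP.
rewrite -(prim_order_dvd prim_eta).
apply: (@lower_weight l n p m0 m1 m2) => //.
- have := triv (a, 1%g); rewrite prod3 /c /= -/m0 -/m1 -/m2.
  rewrite -(expg1 a) -{1}(expg0 b) -{2}(expg0 b)
    !chiE !psiE !expr0 !expr1n mulr1.
  rewrite expr1 mulr1 -exprD => E; rewrite -oa (prim_order_dvd prim_z) E //.
  by apply/setX_cyclicP; exists 1%N, 0%N; rewrite expg0 expg1.
- have := triv (1%g, b); rewrite prod3 /c /= -/m0 -/m1 -/m2.
  rewrite -(expg0 a) -(expg1 b) !chiE !psiE !expr0 !expr1n !mul1r.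
  rewrite expr1 -exprM -exprD => E; rewrite -{1}ob (prim_order_dvd prim_y) E //.
  by apply/setX_cyclicP; exists 0%N, 1%N; rewrite expg0 expg1.
- by rewrite deg_m; exact: leq_ltn_trans d_lt.
Qed.
End Main.

Theorem theorem1p1 (R : realType) (l n : nat) (gT1 gT2 : finGroupType)
    (A : {group gT1}) (B : {group gT2}) (hl : (1 <= l)%N) (hn : (2 <= n)%N)
    (cycA : cyclic A) (cardA : #|A| = (l * n)%N)
    (cycB : cyclic B) (cardB : #|B| = n) :
  beta_sep R (setX_group A B) = (l * n + n %/ pdiv n)%N.
Proof.
have [a defA] := cyclicP cycA; have [b defB] := cyclicP cycB.
rewrite /beta_sep; case: ex_maxnP => d /asboolP[k [rG <-]] dmax.
apply/eqP; rewrite eqn_leq (beta_sep_mod_upper hl hn defA defB cardA cardB) /=.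
have [k' [rG' le]] := beta_sep_mod_lower R hl hn defA defB cardA cardB.
by apply: leq_trans le _; apply: dmax; apply/asboolP; exists k', rG'.
Qed.
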